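(* Let $X\in\mathbb{R}^{n\times p}$ be a matrix with unit $\ell_2$-norm columns satisfying the coherence property with constant $c_\mu>10\sqrt{2}$. Let $\beta\in\mathbb{R}^p$ be a $k$-sparse vector whose support $\mathcal{S}$ is drawn uniformly at random from the $k$-element subsets of $[[p]]$ (the nonzero values of $\beta$ being arbitrary but not depending on the draw), let $\eta\in\mathbb{R}^n$ be independent of $\mathcal{S}$ with independent $\mathcal{N}(0,\sigma^2)$ entries, and $y=X\beta+\eta$. Suppose $p\ge\max\{2n,e^5\}$, $k<\frac{\mu^{-2}}{c_\mu^2\log p}$, and $$\frac{\beta_{\min}}{\|\beta\|_2}>2c_\mu\mu\sqrt{\log p}+\frac{4\sqrt{\sigma^2\log p}}{\|\beta\|_2}.$$ Then, with probability exceeding $1-6p^{-1}$, the output $\hat{\mathcal{S}}$ of Algorithm 1 satisfies $\mathcal{S}\subset\hat{\mathcal{S}}$ for every integer $d\le p$ with $$d\ge\left\lceil\frac{\sqrt{k}}{\frac{\beta_{\min}}{\|\beta\|_2}-2c_\mu\mu\sqrt{\log p}-\frac{4\sqrt{\sigma^2\log p}}{\|\beta\|_2}}\right\rceil.$$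
   Context: For $X$ with unit-norm columns $X_1,\dots,X_p$: worst-case coherence $\mu=\max_{i\ne j}|X_i^\top X_j|$; average coherence $\nu=\frac{1}{p-1}\max_i\big|\sum_{j\ne i}X_i^\top X_j\big|$. Coherence property: there is a constant $c_\mu>0$ such that $\mu<\frac{1}{c_\mu\sqrt{\log p}}$ and $\nu<\frac{\mu}{\sqrt{n}}$. $[[p]]=\{1,\dots,p\}$, $k<n$, $\sigma>0$, $\mathcal{S}=\{i:\beta_i\ne0\}$, $\beta_{\min}=\min_{i\in\mathcal{S}}|\beta_i|$. Algorithm 1: given $X$, $y$ and an integer $d\in\{1,\dots,p\}$, compute $w=X^\top y$ and output $\hat{\mathcal{S}}\subset[[p]]$ with $|\hat{\mathcal{S}}|=d$ such that $|w_i|\ge|w_j|$ for all $i\in\hat{\mathcal{S}}$, $j\notin\hat{\mathcal{S}}$ (ties broken arbitrarily). *)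

(* Defs.v *)
From HB Require Import structures.
From mathcomp Require Import all_boot all_order all_algebra.
From mathcomp Require Import all_classical all_reals all_analysis.
Set Implicit Arguments. Unset Strict Implicit. Unset Printing Implicit Defensive.
Import Order.TTheory GRing.Theory Num.Theory.
Local Open Scope classical_set_scope.
Local Open Scope ring_scope.

Section Defs.
Variable R : realType.

Definition colip n p (X : 'M[R]_(n, p)) (i j : 'I_p) : R :=
  \sum_(r < n) X r i * X r j.

Definition unit_norm_columns n p (X : 'M[R]_(n, p)) : Prop :=
  forall j : 'I_p, colip X j j = 1.

Definition wc_coherence n p (X : 'M[R]_(n, p)) : R :=
  \big[Num.max/0]_(i < p) \big[Num.max/0]_(j < p | j != i) `|colip X i j|.

Definition avg_coherence n p (X : 'M[R]_(n, p)) : R :=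
  (p.-1%:R)^-1 *
  \big[Num.max/0]_(i < p) `|\sum_(j < p | j != i) colip X i j|.

Definition coherence_property n p (X : 'M[R]_(n, p)) (c_mu : R) : Prop :=
  0 < c_mu /\
  wc_coherence X < (c_mu * Num.sqrt (ln p%:R))^-1 /\
  avg_coherence X < wc_coherence X / Num.sqrt n%:R.

(* Algorithm 1 output specification: Shat is a valid output of one-step
   thresholding with w = X^T y, |Shat| = d, ties broken arbitrarily. *)
Definition alg1_output n p (X : 'M[R]_(n, p)) (y : 'cV[R]_n) (d : nat)
    (Shat : {set 'I_p}) : Prop :=
  let w := X^T *m y in
  #|Shat| = d /\
  forall i j : 'I_p, i \in Shat -> j \notin Shat -> `|w j 0| <= `|w i 0|.

(* The k-sparse vector obtained by placing the fixed nonzero values b_1..b_k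
   at the positions f(1),...,f(k) (f injective); its support is the image of f *)
Definition place k p (f : {ffun 'I_k -> 'I_p}) (b : 'I_k -> R) : 'cV[R]_p :=
  \col_(i < p) \sum_(j < k | f j == i) b j.

Definition support_of k p (f : {ffun 'I_k -> 'I_p}) : {set 'I_p} :=
  [set f j | j : 'I_k].

Definition n_inj k p : nat := #|[set f : {ffun 'I_k -> 'I_p} | injectiveb f]|.

Definition l2norm k (b : 'I_k -> R) : R := Num.sqrt (\sum_(j < k) b j ^+ 2).

(* beta_min = min_j |b_j| (the default l2norm b is never attained below the
   minimum when k >= 1, since every |b_j| <= ||b||_2) *)
Definition vmin k (b : 'I_k -> R) : R := \big[Num.min/l2norm b]_(j < k) `|b j|.

End Defs.

(* Main.v *)
Require Import Defs.
From HB Require Import structures.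
From mathcomp Require Import all_boot all_order all_algebra.
From mathcomp Require Import all_classical all_reals all_analysis.
From mathcomp Require Import measurable_realfun.
From mathcomp Require Import ring lra.
Set Implicit Arguments. Unset Strict Implicit. Unset Printing Implicit Defensive.
Import Order.TTheory GRing.Theory Num.Theory.
Local Open Scope classical_set_scope.
Local Open Scope ring_scope.

(** Write [t] for [c_mu * mu * sqrt (log p) * ||beta||] and [u] for
    [2 * sqrt (sigma^2 log p)].  If every column [X_i] has off-diagonal
    correlation with [X beta] below [t] and correlation with the noise below
    [u], then [|w_i| > beta_min - t - u > t + u > |w_j|] for [i] in the support
    and [j] outside it.  Since [beta_min / ||beta|| <= 1 / sqrt k], the lower
    bound on [d] forces [d >= k], and the [d] largest entries contain the
    support.

    For fixed [i] the off-diagonal correlation is [\sum_j b_j g (f j)] for a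
    uniformly random injection [f] and a function [g] with [|g| <= mu] and mean
    at most [nu]; its moment generating function is bounded by revealing the
    values of [f] one at a time.  The noise correlation is [N(0, sigma^2)].
    Chernoff's bound makes each of the [4 p] exceptional events have
    probability at most [p^-2], so together they have probability at most [4/p]. *)

(** * Exponential moments of a random injection *)

Lemma expR_le_invB (R : realType) (x : R) : x < 1 -> expR x <= (1 - x)^-1.
Proof.
move=> x1; rewrite -[x in expR x]opprK expRN lef_pV2 ?posrE ?expR_gt0 ?subr_gt0//.
exact: expR_ge1Dx.
Qed.

(** For [x <= 0] the bound [1 / (1 - x)] suffices. For [0 < x <= 1] it is too weak near 1, so it is
    used only at [x / 8] and carried up by squaring. *)
Lemma expR_le_quadratic (R : realType) (x : R) : x <= 1 -> expR x <= 1 + x + x ^+ 2.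
Proof.
move=> x1; have [x0|x0] := leP x 0.
  have x1' : x < 1 by lra.
  apply: (le_trans (expR_le_invB x1')).
  rewrite -div1r ler_pdivrMr ?subr_gt0//.
  by nra.
have dbl (y : R) : expR (y * 2) = expR y ^+ 2 by rewrite expr2 -expRD; congr expR; lra.
have step (y c c' : R) : 0 <= y -> 0 <= c -> 1 + 2 * c + 2 * c * y + c ^+ 2 * y ^+ 2 <= 4 * c' ->
    expR y <= 1 + y + c * y ^+ 2 -> expR (y * 2) <= 1 + y * 2 + c' * (y * 2) ^+ 2.
  move=> y0 c0 cc' ey; rewrite dbl.
  apply: (@le_trans _ _ ((1 + y + c * y ^+ 2) ^+ 2)).
    by rewrite lerXn2r ?nnegrE ?expR_ge0 // !addr_ge0 // mulr_ge0 // exprn_ge0.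
  rewrite -subr_ge0.
  have -> : 1 + y * 2 + c' * (y * 2) ^+ 2 - (1 + y + c * y ^+ 2) ^+ 2 =
     y ^+ 2 * (4 * c' - (1 + 2 * c + 2 * c * y + c ^+ 2 * y ^+ 2)) by ring.
  by rewrite mulr_ge0 ?sqr_ge0 ?subr_ge0.
(* Three doublings with quadratic coefficients 8/7, 1, 9/10, 1. The start is
   [y^2 / (1 - y) <= 8/7 * y^2] for [y <= 1/8]. The coefficient must drop below 1 before the last
   doubling, since from 1 at [y = 1/2] the side condition of [step] would fail. *)
set y := x / 8.
have y0 : 0 <= y by rewrite /y; lra.
have y1 : y <= 8^-1 by rewrite /y; lra.
have y21 : y ^+ 2 <= 64^-1 by nra.
have e1 : expR y <= 1 + y + 8 / 7 * y ^+ 2.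
  have y1' : y < 1 by lra.
  apply: (le_trans (expR_le_invB y1')).
  rewrite -div1r ler_pdivrMr ?subr_gt0//.
  by nra.
have e2 := step y (8/7) 1 y0 ltac:(lra) ltac:(lra) e1.
have e3 := step (y * 2) 1 (9/10) ltac:(lra) ltac:(lra) ltac:(lra) e2.
have e4 := step (y * 2 * 2) (9/10) 1 ltac:(lra) ltac:(lra) ltac:(lra) e3.
have -> : x = y * 2 * 2 * 2 by rewrite /y; lra.
by rewrite mul1r in e4.
Qed.

Lemma expR_le_addr_expR_sqr (R : realType) (x : R) : expR x <= x + expR (x ^+ 2).
Proof.
have h := expR_ge1Dx (x ^+ 2).
have [x1|x1] := leP x 1.
  by have := expR_le_quadratic x1; lra.
apply: (@le_trans _ _ (expR (x ^+ 2))); last lra.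
by rewrite ler_expR; nra.
Qed.

(* The pointwise bound [e^x <= x + e^(x^2)] has a linear term that averages out
   once [g] is centred, so it replaces Hoeffding's lemma at the cost of a constant. *)
Lemma sum_expR_le_mean (R : realType) (I : finType) (A : {set I}) (g : I -> R) (M c : R) :
  (forall x, `|g x| <= M) ->
  \sum_(x in A) expR (c * g x) <=
    #|A|%:R * expR (c * ((\sum_(x in A) g x) / #|A|%:R) + 4 * c ^+ 2 * M ^+ 2).
Proof.
move=> gM; set m := _ / _.
have [A0|A0] := eqVneq #|A| 0%N.
  by move/eqP: A0; rewrite cards_eq0 => /eqP ->; rewrite big_set0 cards0 mul0r.
have A0' : 0 < #|A|%:R :> R by rewrite ltr0n lt0n.
have sm : \sum_(x in A) g x = #|A|%:R * m by rewrite /m mulrC divfK// gt_eqF.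
have mM : `|m| <= M.
  rewrite -(ler_pM2l A0') -{1}(ger0_norm (ltW A0')) -normrM -sm.
  apply: (le_trans (ler_norm_sum _ _ _)).
  apply: (le_trans (ler_sum _ (fun x _ => gM x))).
  by rewrite sumr_const mulr_natl.
rewrite expRD mulrCA.
apply: (@le_trans _ _ (\sum_(x in A) expR (c * m) * (c * (g x - m) + expR (4 * c ^+ 2 * M ^+ 2)))).
  apply: ler_sum => x _.
  have -> : c * g x = c * m + c * (g x - m) by ring.
  rewrite expRD ler_pM2l ?expR_gt0//.
  apply: (le_trans (expR_le_addr_expR_sqr _)); rewrite lerD2l ler_expR.
  (* Both [g x] and the mean [m] lie in [[-M, M]], so the deviation is at most [2 M]; hence the
     factor 4. *)
  have -> : 4 * c ^+ 2 * M ^+ 2 = c ^+ 2 * (M *+ 2) ^+ 2 by ring.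
  rewrite exprMn ler_wpM2l ?sqr_ge0//.
  have := gM x; move: mM; rewrite !ler_norml => /andP[] ? ? /andP[] ? ?.
  by rewrite -subr_ge0 subr_sqr mulr2n mulr_ge0; lra.
rewrite -mulr_sumr ler_pM2l ?expR_gt0// big_split/= -mulr_sumr sumrB sm.
by rewrite !sumr_const !mulr_natl subrr mulr0 add0r.
Qed.

(** The target set is a parameter because fixing the first value [x] of an injection into [A] leaves
    an injection into [A :\ x]; the induction on [k] shrinks [A] accordingly. *)
Definition inj_into (k : nat) (I : finType) (A : {set I}) (f : {ffun 'I_k -> I}) : bool :=
  injectiveb f && [forall j, f j \in A].

Lemma sum_inj_into_recl (V : nmodType) (k : nat) (I : finType) (A : {set I})
    (F : {ffun 'I_k.+1 -> I} -> V) :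
  \sum_(f | inj_into A f) F f =
  \sum_(x in A) \sum_(f : {ffun 'I_k -> I} | inj_into (A :\ x) f)
     F [ffun j => if unlift ord0 j is Some j' then f j' else x].
Proof.
rewrite (partition_big (fun f : {ffun 'I_k.+1 -> I} => f ord0) (mem A)) /=; last first.
  by move=> f /andP[_ /forallP].
apply: eq_bigr => x xA.
pose h (f : {ffun 'I_k -> I}) : {ffun 'I_k.+1 -> I} :=
  [ffun j => if unlift ord0 j is Some j' then f j' else x].
have h0 f : h f ord0 = x by rewrite ffunE unlift_none.
have hl f j : h f (lift ord0 j) = f j by rewrite ffunE liftK.
rewrite (reindex_onto h (fun f => [ffun j => f (lift ord0 j)])) /=; last first.
  move=> f /andP[_ /eqP f0]; apply/ffunP => j.
  by case: (unliftP ord0 j) => [j' ->|->]; rewrite ?h0 ?hl ?ffunE.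
apply: eq_bigl => f; rewrite h0 eqxx andbT.
have -> : [ffun j => h f (lift ord0 j)] = f by apply/ffunP => j; rewrite ffunE hl.
rewrite eqxx andbT /inj_into; apply/andP/andP => -[/injectiveP fi /forallP fA]; split.
- by apply/injectiveP => i j ij; apply: (@lift_inj _ ord0); apply: fi; rewrite !hl.
- apply/forallP => j; rewrite !inE -hl fA andbT -[X in _ != X](h0 f).
  by apply/eqP => /fi /eqP; rewrite eq_sym (negbTE (neq_lift _ _)).
- have fx j : f j != x by have := fA j; rewrite !inE => /andP[].
  apply/injectiveP => i j.
  case: (unliftP ord0 i) => [i' ->|->]; case: (unliftP ord0 j) => [j' ->|->] //; rewrite ?h0 ?hl.
  + by move=> /fi ->.
  + by move=> e; have := fx i'; rewrite e eqxx.
  + by move=> e; have := fx j'; rewrite e eqxx.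
- apply/forallP => j; case: (unliftP ord0 j) => [j' ->|->]; rewrite ?h0 ?hl//.
  by have := fA j'; rewrite !inE => /andP[].
Qed.

(* Drawing the values in order, the exponent is affine in the first value
   [g x]: the conditional mean of [g] over [A :\ x] is [(sum - g x) / (#|A| - 1)]. *)
Lemma sum_inj_into_expR_le (R : realType) (I : finType) (g : I -> R) (M : R) (K : nat) (s : R) :
  (forall x, `|g x| <= M) -> (0 < K)%N ->
  forall (k : nat) (A : {set I}) (a : 'I_k -> R), (K + k <= #|A|)%N ->
  \sum_(j < k) `|a j| <= s ->
  \sum_(f | inj_into A f) expR (\sum_(j < k) a j * g (f j)) <=
  (#|A| ^_ k)%:R * expR ((\sum_(j < k) a j) * ((\sum_(x in A) g x) / #|A|%:R)
     + 4 * M ^+ 2 * \sum_(j < k) (2 * a j ^+ 2 + 2 * (s / K%:R) ^+ 2)).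
Proof.
move=> gM K0; elim => [|k IHk] A a KA sa.
  rewrite !big_ord0 mul0r mulr0 addr0 expR0 ffactn0 mulr1.
  rewrite (eq_bigr (fun=> 1)); last by move=> f _; rewrite big_ord0 expR0.
  rewrite sumr_const ler_nat (leq_trans (max_card _))//.
  by rewrite card_ffun card_ord expn0.
rewrite sum_inj_into_recl.
set a' := fun j : 'I_k => a (lift ord0 j); set m := #|A|; set G := \sum_(x in A) g x.
set a0 := a ord0; set s' := \sum_(j < k) a' j.
set W := \sum_(j < k) (2 * a' j ^+ 2 + 2 * (s / K%:R) ^+ 2).
have sa' : \sum_(j < k) `|a' j| <= s.
  by move: sa; rewrite big_ord_recl; apply: le_trans; rewrite lerDr.
have s's : `|s'| <= s by apply: le_trans sa'; exact: ler_norm_sum.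
(* [K] bounds from below the number of points left after any draw, and [s] bounds the remaining
   weights, so the shift [s' / m.-1] of the coefficient below never exceeds [s / K] in absolute
   value. *)
have m1K : (K <= m.-1)%N by rewrite -ltnS prednK ?(leq_trans _ KA)// ?addnS ?ltnS ?leq_addr.
have m1n : (0 < m.-1)%N by rewrite (leq_trans K0).
have m10 : 0 < m.-1%:R :> R by rewrite ltr0n.
have mE : m%:R = m.-1%:R + 1 :> R.
  by rewrite natr1 prednK// (leq_trans _ KA)// addnS.
(* The total coefficient of [g x]: [a0] directly, and [- s' / m.-1] because drawing [x] removes it
   from the mean seen by the later draws. *)
set c := a0 - s' / m.-1%:R.
have step x : x \in A ->
  \sum_(f : {ffun 'I_k -> I} | inj_into (A :\ x) f)
    expR (\sum_(j < k.+1) a j * g ([ffun j => if unlift ord0 j is Some j' then f j' else x] j)) <=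
  (m.-1 ^_ k)%:R * expR (s' * (G / m.-1%:R) + 4 * M ^+ 2 * W) * expR (c * g x).
  move=> xA.
  have cA : #|A :\ x| = m.-1 by rewrite /m (cardsD1 x A) xA.
  have sA : \sum_(y in A :\ x) g y = G - g x.
    by rewrite /G (big_setD1 x xA)/= addrC addrK.
  have := IHk (A :\ x) a'; rewrite cA sA => /(_ _ sa') IH.
  have {}IH := IH _.
  under eq_bigr => f _.
    rewrite big_ord_recl ffunE unlift_none expRD.
    under eq_bigr => j _ do rewrite ffunE liftK.
    over.
  rewrite -mulr_sumr mulrC.
  have -> : (m.-1 ^_ k)%:R * expR (s' * (G / m.-1%:R) + 4 * M ^+ 2 * W) * expR (c * g x) =
     ((m.-1 ^_ k)%:R * expR (s' * ((G - g x) / m.-1%:R) + 4 * M ^+ 2 * W)) * expR (a0 * g x).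
    rewrite -!mulrA -!expRD; congr (_ * expR _); rewrite /c; field.
    by rewrite gt_eqF.
  rewrite ler_pM2r ?expR_gt0//; apply: IH.
  by rewrite -ltnS prednK ?(leq_trans _ KA)// ?addnS// ltnS.
apply: (le_trans (ler_sum _ step)).
rewrite -mulr_sumr.
have H := sum_expR_le_mean A c gM.
rewrite -/m -/G in H.
apply: (le_trans (ler_wpM2l _ H)); first by rewrite mulr_ge0 ?expR_ge0.
rewrite ffactnS natrM mulrACA [X in X * _]mulrC ler_wpM2l ?mulr_ge0//.
rewrite mulrC -expRD ler_expR !big_ord_recl -/a0 -/s' -/W.
have cs : c ^+ 2 <= 2 * a0 ^+ 2 + 2 * (s / K%:R) ^+ 2.
  have : (s' / m.-1%:R) ^+ 2 <= (s / K%:R) ^+ 2.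
    rewrite -[(s' / _) ^+ 2]real_normK ?num_real// lerXn2r ?nnegrE//.
      by rewrite divr_ge0// (le_trans _ s's).
    rewrite normrM normfV (ger0_norm (ltW m10)) ler_pM ?invr_ge0//.
    by rewrite lef_pV2 ?posrE ?ltr0n// ler_nat.
  rewrite /c; set u := s' / _ => uK.
  have := sqr_ge0 (a0 + u); nra.
(* The linear terms recombine exactly, since removing a uniformly chosen point leaves the expected
   mean [G / m] unchanged. Only the quadratic errors accumulate. *)
have -> : c * (G / m%:R) + 4 * c ^+ 2 * M ^+ 2 + (s' * (G / m.-1%:R) + 4 * M ^+ 2 * W) =
   (a0 + s') * (G / m%:R) + (4 * M ^+ 2) * (c ^+ 2 + W).
  rewrite /c mE; field.
  by rewrite !gt_eqF// -mE ltr0n (leq_trans _ KA)// addnS.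
rewrite lerD2l; apply: ler_wpM2l; first by rewrite mulr_ge0 ?sqr_ge0.
exact: (lerD cs (lexx W)).
Qed.

(** Cauchy-Schwarz against the constant vector, read off from the nonnegative sum of the
    [(k a_j - s)^2]. *)
Lemma sqr_sum_le (R : realFieldType) (k : nat) (a : 'I_k -> R) :
  (\sum_(j < k) a j) ^+ 2 <= k%:R * \sum_(j < k) a j ^+ 2.
Proof.
case: k a => [|k] a; first by rewrite !big_ord0 expr0n mulr0.
set s := \sum_(j < _) a j; set q := \sum_(j < _) _.
have k0 : 0 < k.+1%:R :> R by rewrite ltr0n.
have : 0 <= \sum_(j < k.+1) (k.+1%:R * a j - s) ^+ 2 by apply: sumr_ge0 => j _; exact: sqr_ge0.
have -> : \sum_(j < k.+1) (k.+1%:R * a j - s) ^+ 2 = k.+1%:R * (k.+1%:R * q - s ^+ 2).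
  transitivity (\sum_(j < k.+1) (k.+1%:R ^+ 2 * a j ^+ 2 - 2 * k.+1%:R * s * a j + s ^+ 2)).
    by apply: eq_bigr => j _; ring.
  rewrite big_split/= sumrB -!mulr_sumr -/s -/q sumr_const card_ord -mulr_natl.
  by ring.
by rewrite pmulr_rge0// subr_ge0.
Qed.

Lemma n_injE (k p : nat) : n_inj k p = (p ^_ k)%N.
Proof.
rewrite -[p in RHS]card_ord -[k in RHS]card_ord -card_inj_ffuns; apply: eq_card => f.
by rewrite [RHS]inE; apply/idP/idP => [/set_mem|fi] //; apply: mem_set.
Qed.

(** Exponential Markov inequality for the counting measure on injections, with the weights
    [l * b j]. The moment bound is taken with [K = k], which is where [k + k <= p] enters. *)
Lemma card_inj_tail_le (R : realType) (k p : nat) (g : 'I_p -> R) (M : R) (b : 'I_k -> R) (t l : R) :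
  (0 < k)%N -> (k + k <= p)%N -> (forall x, `|g x| <= M) -> 0 <= l ->
  #|[set f : {ffun 'I_k -> 'I_p} | injectiveb f & t <= \sum_(j < k) b j * g (f j)]%SET|%:R <=
  (n_inj k p)%:R * expR (- (l * t) + l * ((\sum_(j < k) b j) * ((\sum_x g x) / p%:R))
     + 16 * M ^+ 2 * (l ^+ 2 * \sum_(j < k) b j ^+ 2)).
Proof.
move=> k0 kp gM l0.
have kR : 0 < k%:R :> R by rewrite ltr0n.
pose a j := l * b j; pose s := \sum_(j < k) `|a j|.
have cA : #|[set: 'I_p]%SET| = p by rewrite cardsT card_ord.
have := @sum_inj_into_expR_le R _ g M k s gM k0 k [set: 'I_p]%SET a.
rewrite cA => /(_ kp (lexx _)).
rewrite (eq_bigl (fun f : {ffun 'I_k -> 'I_p} => injectiveb f)); last first.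
  by move=> f; rewrite /inj_into; case: (injectiveb f) => //=; apply/forallP => j; rewrite inE.
have -> : \sum_(x in [set: 'I_p]%SET) g x = \sum_x g x by apply: eq_bigl => x; rewrite inE.
set G := \sum_x g x => H.
have nE := n_injE k p.
rewrite -ler_pdivrMl; last by rewrite ltr0n nE ffact_gt0 (leq_trans _ kp)// leq_addr.
rewrite -addrA expRD -ler_pdivrMl ?expR_gt0// -expRN opprK.
rewrite mulrCA ler_pdivrMl; last by rewrite ltr0n nE ffact_gt0 (leq_trans _ kp)// leq_addr.
rewrite nE; apply: (le_trans _ (le_trans H _)).
  rewrite -sum1dep_card natr_sum mulr_sumr.
  rewrite big_mkcondr; apply: ler_sum => f _; case: ifP => tf; last exact: expR_ge0.
  rewrite mulr1 ler_expR (le_trans (ler_wpM2l l0 tf))// mulr_sumr.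
  by rewrite le_eqVlt; apply/orP; left; apply/eqP; apply: eq_bigr => j _; rewrite mulrA.
have aE : \sum_(j < k) a j = l * \sum_(j < k) b j by rewrite mulr_sumr.
rewrite aE -[l * _ * _]mulrA ler_wpM2l// ler_expR lerD2l.
have -> : 16 * M ^+ 2 * (l ^+ 2 * \sum_(j < k) b j ^+ 2) =
    4 * M ^+ 2 * (4 * (l ^+ 2 * \sum_(j < k) b j ^+ 2)) by ring.
apply: ler_wpM2l; first by rewrite mulr_ge0 ?sqr_ge0.
have a2 : \sum_(j < k) a j ^+ 2 = l ^+ 2 * \sum_(j < k) b j ^+ 2.
  by rewrite mulr_sumr; apply: eq_bigr => j _; rewrite exprMn.
(* With [K = k], Cauchy-Schwarz bounds the [k] correction terms [(s / k)^2] together by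
   [l^2 * ||b||^2], the same size as the main term. The sum is then at most [4 * l^2 * ||b||^2], and
   [4 * 4] gives the constant 16. *)
have s2 : s ^+ 2 <= k%:R * (l ^+ 2 * \sum_(j < k) b j ^+ 2).
  apply: (le_trans (sqr_sum_le _)); rewrite -a2.
  by under eq_bigr do rewrite real_normK ?num_real//.
rewrite big_split/= -mulr_sumr a2 sumr_const card_ord -[_ *+ k]mulr_natl expr_div_n.
have -> : k%:R * (2 * (s ^+ 2 / k%:R ^+ 2)) = 2 * (s ^+ 2 / k%:R).
  by field; rewrite gt_eqF.
have : s ^+ 2 / k%:R <= l ^+ 2 * \sum_(j < k) b j ^+ 2 by rewrite ler_pdivrMr// mulrC.
by lra.
Qed.

(** * Independence and Gaussian tails *)

Section weighted_transfer.
Context (R : realType) (d d' : measure_display) (T : measurableType d) (Y : measurableType d').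
Variables (mu : {measure set T -> \bar R}) (nu : {measure set Y -> \bar R}).
Variables (phi : T -> Y) (h : T -> R) (c : \bar R).
Hypothesis mphi : measurable_fun setT phi.
Hypothesis mh : measurable_fun setT h.
Hypothesis h0 : forall x, 0 <= h x.
Hypothesis cfin : c \is a fin_num.
Hypothesis hB : forall B, measurable B ->
  (\int[mu]_x (h x * \1_B (phi x))%:E = c * nu B)%E.

Import HBNNSimple.

Let weighted_nnsfun (f : {nnsfun Y >-> R}) :
  (\int[mu]_x (h x * f (phi x))%:E = c * \int[nu]_y (f y)%:E)%E.
Proof.
have mfr r : measurable (f @^-1` [set r]) by exact: measurable_sfunP.
transitivity (\int[mu]_x (\sum_(r \in range f) r%:E * (h x * \1_(f @^-1` [set r]) (phi x))%:E))%E.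
  apply: eq_integral => x _.
  rewrite {1}fimfunE EFinM -fsumEFin// ge0_mule_fsumr; last first.
    by move=> r; exact: nnfun_muleindic_ge0.
  by apply: eq_fsbigr => r _; rewrite -!EFinM mulrCA.
have mhr r : measurable_fun setT (fun x => h x * \1_(f @^-1` [set r]) (phi x)).
  apply: measurable_funM => //.
  by apply: (measurableT_comp _ mphi); exact: measurable_indic.
have pos (r : R) x : (0 <= r%:E * (h x * \1_(f @^-1` [set r]) (phi x))%:E)%E.
  rewrite -EFinM lee_fin mulrCA mulr_ge0//.
  by have := nnfun_muleindic_ge0 f r (phi x); rewrite lee_fin.
rewrite ge0_integral_fsum//; last first.
  by move=> r; apply/measurable_EFinP; apply: measurable_funM.
rewrite [in RHS]integralT_nnsfun sintegralE ge0_mule_fsumr; last first.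
  by move=> r; exact: nnsfun_mulemu_ge0.
apply: eq_fsbigr => r /set_mem[y _ <-].
rewrite ge0_integralZl//.
- by rewrite hB// muleCA.
- exact/measurable_EFinP.
- by move=> x _; rewrite lee_fin mulr_ge0.
- by rewrite lee_fin.
Qed.

(** Extends [hB] from indicators to nonnegative measurable functions through simple functions and
    monotone convergence. It serves twice: with [h] the product of the other factors, to exploit
    independence, and with [h] the normal density, to pass to Lebesgue measure. *)
Lemma ge0_integral_weighted (f : Y -> R) :
  measurable_fun setT f -> (forall y, 0 <= f y) ->
  (\int[mu]_x (h x * f (phi x))%:E = c * \int[nu]_y (f y)%:E)%E.
Proof.
move=> mf f0.
have mf' : measurable_fun setT (EFin \o f) by exact/measurable_EFinP.
pose g := nnsfun_approx measurableT mf'.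
have gf y : (EFin \o g^~ y) @ \oo --> (f y)%:E.
  by apply: cvg_nnsfun_approx => // x _; rewrite lee_fin.
have ndg y : {homo g^~ y : m n / (m <= n)%N >-> m <= n}.
  by move=> m n mn; exact/lefP/nd_nnsfun_approx.
have -> : (\int[nu]_y (f y)%:E = limn (fun n => \int[nu]_y (g n y)%:E))%E.
  rewrite -monotone_convergence//.
  - by apply: eq_integral => y _; apply/esym/cvg_lim => //; exact: gf.
  - by move=> n; exact/measurable_EFinP/measurable_funP.
  - by move=> n y _; rewrite lee_fin.
  - by move=> y _ m n mn; rewrite lee_fin ndg.
have -> : (\int[mu]_x (h x * f (phi x))%:E =
    limn (fun n => \int[mu]_x (h x * g n (phi x))%:E))%E.
  rewrite -monotone_convergence//.
  - apply: eq_integral => x _; apply/esym/cvg_lim => //.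
    rewrite EFinM; under eq_fun do rewrite EFinM.
    by apply: cvgeZl => //; exact: gf.
  - move=> n; apply/measurable_EFinP/measurable_funM => //.
    by apply: measurableT_comp => //; exact/measurable_funP.
  - by move=> n x _; rewrite lee_fin mulr_ge0.
  - by move=> x _ m n mn; rewrite lee_fin ler_wpM2l// ndg.
under eq_fun do rewrite weighted_nnsfun.
rewrite limeMl//; apply: ereal_nondecreasing_is_cvgn => m n mn.
apply: ge0_le_integral => //.
- by move=> y _; rewrite lee_fin.
- exact/measurable_EFinP/measurable_funP.
- exact/measurable_EFinP/measurable_funP.
- by move=> y _; rewrite lee_fin ndg.
Qed.

End weighted_transfer.

Lemma integral_prod_independent (R : realType) (d d' : measure_display)
    (T : measurableType d) (Y : measurableType d') (P : probability T R)
    (nu : probability Y R) (n : nat) (eta : 'I_n -> T -> Y) :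
  (forall i, measurable_fun setT (eta i)) ->
  (forall B : 'I_n -> set Y, (forall i, measurable (B i)) ->
    P (\bigcap_(i in [set: 'I_n]) (eta i @^-1` B i)) = (\prod_(i < n) nu (B i))%E) ->
  forall f : 'I_n -> Y -> R,
  (forall i, measurable_fun setT (f i)) -> (forall i y, 0 <= f i y) ->
  (forall i, (\int[nu]_y (f i y)%:E)%E \is a fin_num) ->
  (\int[P]_w (\prod_(i < n) f i (eta i w))%:E = \prod_(i < n) \int[nu]_y (f i y)%:E)%E.
Proof.
move=> meta indep.
(* The indicators outside [s] are replaced by general functions one index at a time. *)
suff gen (s : seq 'I_n) : forall f : 'I_n -> Y -> R,
    (forall i, measurable_fun setT (f i)) -> (forall i y, 0 <= f i y) ->
    (forall i, (\int[nu]_y (f i y)%:E)%E \is a fin_num) ->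
    (forall i, i \notin s -> exists2 B, measurable B & f i = \1_B) ->
    (\int[P]_w (\prod_(i < n) f i (eta i w))%:E = \prod_(i < n) \int[nu]_y (f i y)%:E)%E.
  move=> f mf f0 ffin; apply: (gen (enum 'I_n)) => // i.
  by rewrite mem_enum.
elim: s => [|i0 s IHs] f mf f0 ffin fs.
  have /choice[B BE] : forall i, exists B, measurable B /\ f i = \1_B.
    by move=> i; have [B mB fB] := fs i isT; exists B.
  have mB i : measurable (B i) by have [] := BE i.
  have fB i : f i = \1_(B i) by have [] := BE i.
  transitivity (\int[P]_w (\1_(\bigcap_(i in [set: 'I_n]) (eta i @^-1` B i)) w)%:E)%E.
    apply: eq_integral => w _; congr EFin.
    rewrite indicE; case: (boolP (w \in _)) => [/set_mem wB|wB].
      by rewrite big1// => i _; rewrite fB indicE mem_set//; exact: wB.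
    have [i iB] : exists i, eta i w \notin B i.
      apply: contrapT => /forallNP nB; move/negP: wB; apply; apply/mem_set => i _.
      by have /negP/negPn/set_mem := nB i.
    by rewrite (bigD1 i)//= fB indicE (negbTE iB) mul0r.
  rewrite integral_indic//; last first.
    apply: fin_bigcap_measurable => // i _; rewrite -[X in measurable X]setTI.
    exact: meta.
  rewrite setIT; apply: (etrans (indep B mB)); apply: eq_bigr => i _.
  by rewrite fB integral_indic// setIT.
pose h w := \prod_(i < n | i != i0) f i (eta i w).
pose c := (\prod_(i < n | i != i0) \int[nu]_y (f i y)%:E)%E.
have -> : (\int[P]_w (\prod_(i < n) f i (eta i w))%:E =
    \int[P]_w (h w * f i0 (eta i0 w))%:E)%E.
  by apply: eq_integral => w _; rewrite (bigD1 i0)//= mulrC.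
rewrite (bigD1 i0)//= muleC -/c.
apply: ge0_integral_weighted => //.
- have -> : h = fun w => \prod_(i < n) (if i != i0 then f i (eta i w) else 1).
    by apply/funext => w; rewrite /h big_mkcond.
  apply: (@measurable_prod _ _ _ _ _ _ (fun i w => if i != i0 then f i (eta i w) else 1)).
  by move=> i _; case: (i != i0) => //; apply: measurableT_comp.
- by move=> w; apply: prodr_ge0.
- by rewrite /c; apply: prode_fin_num => i _.
- move=> B mB.
  (* With an indicator in slot [i0], every slot outside [s] holds an indicator, so the induction
     hypothesis yields the identity on indicators that the transfer lemma requires. *)
  pose f' i := if i == i0 then \1_B else f i.
  have nuB : (\int[nu]_y (\1_B y)%:E = nu B)%E by rewrite integral_indic// setIT.
  have f'0 : f' i0 = \1_B by rewrite /f' eqxx.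
  have f'N i : i != i0 -> f' i = f i by rewrite /f' => /negbTE ->.
  transitivity (\int[P]_w (\prod_(i < n) f' i (eta i w))%:E)%E.
    apply: eq_integral => w _; rewrite [in RHS](bigD1 i0)//= f'0 mulrC.
    by congr (_ * _)%:E; apply: eq_bigr => i ii0; rewrite f'N.
  rewrite IHs; first last.
  - move=> i is'; case: (eqVneq i i0) => [->|ii0]; first by exists B.
    by rewrite f'N//; apply: fs; rewrite inE negb_or ii0.
  - move=> i; case: (eqVneq i i0) => [->|ii0]; last by rewrite f'N.
    by rewrite f'0 nuB; exact: fin_num_measure.
  - by move=> i y; case: (eqVneq i i0) => [->|ii0]; rewrite ?f'0 ?f'N.
  - by move=> i; case: (eqVneq i i0) => [->|ii0]; rewrite ?f'0 ?f'N.
  rewrite (bigD1 i0)//= f'0 nuB muleC; congr (_ * _)%E.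
  by apply: eq_bigr => i ii0; rewrite f'N.
Qed.

(** Completing the square: [expR (a * x)] times the centred density is [expR (a^2 sigma^2 / 2)]
    times the density centred at [a * sigma^2], which integrates to 1. *)
Lemma normal_prob_mgf (R : realType) (sigma a : R) : 0 < sigma ->
  (\int[normal_prob 0 sigma]_x (expR (a * x))%:E = (expR (a ^+ 2 * sigma ^+ 2 / 2))%:E)%E.
Proof.
move=> s0.
have sn0 : sigma != 0 by rewrite gt_eqF.
have mexp : measurable_fun [set: R] (fun x : R => expR (a * x)).
  by apply: measurableT_comp => //; exact: measurable_funM.
have := @ge0_integral_weighted R _ _ _ _ lebesgue_measure (normal_prob 0 sigma)
  idfun (normal_pdf 0 sigma) 1%E.
move=> /(_ (@measurable_id _ _ _) (measurable_normal_pdf 0 sigma)).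
move=> /(_ (normal_pdf_ge0 0 sigma) isT).
have dens (B : set R) : measurable B ->
    (\int[lebesgue_measure]_x (normal_pdf 0 sigma x * \1_B x)%:E = 1 * normal_prob 0 sigma B)%E.
  move=> mB; rewrite mul1e /normal_prob [in RHS]integral_mkcond.
  apply: eq_integral => x _; rewrite patchE.
  by rewrite indicE; case: (x \in B); rewrite ?mulr1 ?mulr0.
move=> /(_ dens _ mexp (fun y => expR_ge0 _)); rewrite mul1e => <-.
transitivity (\int[lebesgue_measure]_x ((expR (a ^+ 2 * sigma ^+ 2 / 2))%:E *
    (normal_pdf (a * sigma ^+ 2) sigma x)%:E))%E; last first.
  rewrite ge0_integralZl ?integral_normal_pdf ?mule1 ?lee_fin ?expR_ge0//.
  - by apply/measurable_EFinP; exact: measurable_normal_pdf.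
  - by move=> x _; rewrite lee_fin normal_pdf_ge0.
apply: eq_integral => x _; rewrite -EFinM; congr EFin.
rewrite /= !normal_pdfE// /normal_fun [RHS]mulrCA -!mulrA -!expRD; congr (_ * expR _).
by field.
Qed.

Lemma measurable_exists_in (d : measure_display) (T : measurableType d) (I : eqType) (s : seq I)
    (F : I -> set T) : (forall i, measurable (F i)) ->
  measurable [set w | exists2 i, i \in s & F i w].
Proof.
move=> mF; elim: s => [|i s IHs].
  by rewrite [X in measurable X](_ : _ = set0)// -subset0 => w [].
rewrite [X in measurable X](_ : _ = F i `|` [set w | exists2 i, i \in s & F i w]).
  exact: measurableU.
apply/seteqP; split => w /=.
  by move=> [j]; rewrite inE => /orP[/eqP -> ?|js Fj]; [left|right; exists j].
by case=> [Fi|[j js Fj]]; [exists i => //; rewrite mem_head|exists j => //; rewrite inE js orbT].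
Qed.

Lemma measure_exists_in_le (R : realType) (d : measure_display) (T : measurableType d)
    (mu : {measure set T -> \bar R}) (I : eqType) (s : seq I) (F : I -> set T) :
  (forall i, measurable (F i)) ->
  (mu [set w | exists2 i, i \in s & F i w] <= \sum_(i <- s) mu (F i))%E.
Proof.
move=> mF; elim: s => [|i s IHs].
  by rewrite big_nil [X in mu X](_ : _ = set0) ?measure0// -subset0 => w [].
rewrite big_cons [X in mu X](_ : _ = F i `|` [set w | exists2 i, i \in s & F i w]).
  apply: (le_trans (measureU2 _ _ _)) => //; first exact: measurable_exists_in.
  exact: leeD2l.
apply/seteqP; split => w /=.
  by move=> [j]; rewrite inE => /orP[/eqP -> ?|js Fj]; [left|right; exists j].
by case=> [Fi|[j js Fj]]; [exists i => //; rewrite mem_head|exists j => //; rewrite inE js orbT].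
Qed.

(** Independence turns the moment generating function into a product, and the unit norm of [x] makes
    that product the one of [N(0, sigma^2)]; the law of the combination itself is never computed. *)
Lemma gaussian_comb_tail_le (R : realType) (d : measure_display) (T : measurableType d)
    (P : probability T R) (n : nat) (eta : 'I_n -> T -> R) (sigma t : R) (x : 'I_n -> R) :
  0 < sigma -> 0 < t ->
  (forall i, measurable_fun setT (eta i)) ->
  (forall B : 'I_n -> set R, (forall i, measurable (B i)) ->
    P (\bigcap_(i in [set: 'I_n]) (eta i @^-1` B i)) =
    (\prod_(i < n) normal_prob 0 sigma (B i))%E) ->
  \sum_(i < n) x i ^+ 2 = 1 ->
  (P [set w | (t <= \sum_(i < n) x i * eta i w)%R] <= (expR (- (t ^+ 2 / (2 * sigma ^+ 2))))%:E)%E.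
Proof.
move=> s0 t0 meta indep x1.
pose Z w := \sum_(i < n) x i * eta i w.
have mZ : measurable_fun setT Z.
  by apply: measurable_sum => i; apply: measurable_funM.
pose Z' : {RV P >-> R} := HB.pack Z (isMeasurableFun.Build _ _ _ _ _ mZ).
(* The minimiser of the Chernoff exponent [r^2 sigma^2 / 2 - r t]. *)
pose r := t / sigma ^+ 2.
have r0 : 0 < r by rewrite divr_gt0// exprn_gt0.
apply: (le_trans (chernoff Z' t r0)).
have -> : 'M_P Z' r = (expR (r ^+ 2 * sigma ^+ 2 / 2))%:E.
  rewrite /mmt_gen_fun unlock.
  transitivity (\int[P]_w (\prod_(i < n) expR (r * x i * eta i w))%:E)%E.
    apply: eq_integral => w _ /=; rewrite -expR_sum; congr (expR _)%:E.
    by rewrite /Z mulr_suml; apply: eq_bigr => i _; rewrite mulrC mulrA.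
  have mgf i := normal_prob_mgf (r * x i) s0.
  rewrite (integral_prod_independent (nu := normal_prob 0 sigma) meta indep
    (f := fun i y => expR (r * x i * y))).
  - under eq_bigr => i _ do rewrite mgf.
    rewrite prodEFin -expR_sum; congr (expR _)%:E.
    transitivity (\sum_(i < n) x i ^+ 2 * (r ^+ 2 * sigma ^+ 2 / 2)).
      by apply: eq_bigr => i _; ring.
    by rewrite -mulr_suml x1 mul1r.
  - by move=> i; apply: measurableT_comp => //; exact: measurable_funM.
  - by move=> i y; exact: expR_ge0.
  - by move=> i; rewrite mgf.
rewrite -EFinM lee_fin -expRD ler_expR /r le_eqVlt; apply/orP; left; apply/eqP.
by field; rewrite gt_eqF.
Qed.

(** * Correlations and support recovery *)

Section Correlations.
Variables (R : realType) (n p : nat) (X : 'M[R]_(n, p)).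

(** The diagonal entry is set to 0 so that the function is bounded by [wc_coherence X] at every
    index and its full sum is the one controlled by [avg_coherence X]. *)
Definition offdiag (i m : 'I_p) : R := if m == i then 0 else colip X i m.

Lemma wc_coherence_ge0 : 0 <= wc_coherence X.
Proof. exact: bigmax_ge_id. Qed.

Lemma offdiag_le (i m : 'I_p) : `|offdiag i m| <= wc_coherence X.
Proof.
rewrite /offdiag; case: eqVneq => [_|mi]; first by rewrite normr0 wc_coherence_ge0.
apply: (le_trans _ (le_bigmax _ _ i)).
exact: (le_bigmax_cond 0 (fun j => `|colip X i j|) mi).
Qed.

Lemma offdiag_sum_le (i : 'I_p) : (1 < p)%N ->
  `|\sum_m offdiag i m| <= p.-1%:R * avg_coherence X.
Proof.
move=> p1; have p10 : 0 < p.-1%:R :> R by rewrite ltr0n -ltnS prednK// ltnW.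
rewrite /avg_coherence mulrA divff ?gt_eqF// mul1r.
have -> : \sum_m offdiag i m = \sum_(j < p | j != i) colip X i j.
  by rewrite [RHS]big_mkcond; apply: eq_bigr => m _; rewrite /offdiag; case: eqVneq.
exact: (le_bigmax 0 (fun i => `|\sum_(j < p | j != i) colip X i j|) i).
Qed.

Variables (k : nat) (b : 'I_k -> R) (f : {ffun 'I_k -> 'I_p}).

Lemma trmx_mul_placeE (e : 'cV[R]_n) (i : 'I_p) :
  (X^T *m (X *m place f b + e)) i 0 =
  \sum_(j < k) b j * colip X i (f j) + \sum_(r < n) X r i * e r 0.
Proof.
rewrite mulmxDr mxE; congr (_ + _); last first.
  by rewrite mxE; apply: eq_bigr => r _; rewrite mxE.
rewrite mulmxA mxE.
transitivity (\sum_(m < p) \sum_(j < k | f j == m) b j * colip X i (f j)).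
  apply: eq_bigr => m _; rewrite !mxE mulr_sumr; apply: eq_bigr => j /eqP ->.
  by rewrite mulrC; congr (_ * _); apply: eq_bigr => r _; rewrite mxE.
by rewrite [RHS](partition_big f predT).
Qed.

Lemma colip_sum_offdiag_out (i : 'I_p) : i \notin support_of f ->
  \sum_(j < k) b j * colip X i (f j) = \sum_(j < k) b j * offdiag i (f j).
Proof.
move=> iS; apply: eq_bigr => j _; rewrite /offdiag; case: eqVneq => // fji.
by case/negP: iS; rewrite -fji; apply: imset_f.
Qed.

Lemma colip_sum_offdiag_in (l : 'I_k) : unit_norm_columns X -> injective f ->
  \sum_(j < k) b j * colip X (f l) (f j) = b l + \sum_(j < k) b j * offdiag (f l) (f j).
Proof.
move=> X1 fi; rewrite (bigD1 l)//= X1 mulr1 [in RHS](bigD1 l)//= /offdiag eqxx mulr0 add0r.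
by congr (_ + _); apply: eq_bigr => j jl; rewrite (inj_eq fi) (negbTE jl).
Qed.

End Correlations.

(** If some [i] in [S] were missed, no [j] outside [S] could be selected, as it would have to beat
    [i]. Then [Shat] would be a proper subset of [S], against [#|S| <= d]. *)
Lemma alg1_output_support_subset (R : realType) (n p : nat) (X : 'M[R]_(n, p)) (y : 'cV[R]_n)
    (d : nat) (S Shat : {set 'I_p}) :
  (forall i j, i \in S -> j \notin S -> `|(X^T *m y) j 0| < `|(X^T *m y) i 0|) ->
  (#|S| <= d)%N -> alg1_output X y d Shat -> S \subset Shat.
Proof.
move=> sep Sd [cS top]; apply/fintype.subsetP => i iS; apply: contraT => iShat.
have : Shat \proper S.
  apply/fintype.properP; split; last by exists i.
  apply/fintype.subsetP => j jShat; apply: contraT => jS.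
  by have := top j i jShat iShat; rewrite leNgt (sep i j).
by move/proper_card; rewrite cS ltnNge Sd.
Qed.

Lemma l2norm_gt0 (R : realType) (k : nat) (b : 'I_k -> R) : (0 < k)%N -> (forall j, b j != 0) ->
  0 < l2norm b.
Proof.
case: k b => // k b _ b0; rewrite sqrtr_gt0 big_ord_recl ltr_pwDl//.
  by rewrite exprn_even_gt0//= b0.
by apply: sumr_ge0 => j _; exact: sqr_ge0.
Qed.

Lemma sqr_l2norm (R : realType) (k : nat) (b : 'I_k -> R) :
  l2norm b ^+ 2 = \sum_(j < k) b j ^+ 2.
Proof. by rewrite sqr_sqrtr// sumr_ge0// => j _; exact: sqr_ge0. Qed.

Lemma vmin_le (R : realType) (k : nat) (b : 'I_k -> R) (j : 'I_k) : vmin b <= `|b j|.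
Proof. exact: bigmin_le_cond. Qed.

Lemma vmin_ge0 (R : realType) (k : nat) (b : 'I_k -> R) : 0 <= vmin b.
Proof. by apply: le_bigmin => // ; exact: sqrtr_ge0. Qed.

Lemma sqrt_vmin_le_l2norm (R : realType) (k : nat) (b : 'I_k -> R) :
  Num.sqrt k%:R * vmin b <= l2norm b.
Proof.
have v0 := vmin_ge0 b.
rewrite -[vmin b]ger0_norm// -sqrtr_sqr -sqrtrM// ler_sqrt; last first.
  by rewrite sumr_ge0// => j _; exact: sqr_ge0.
rewrite mulr_natl -[X in _ *+ X]card_ord -sumr_const; apply: ler_sum => j _.
by rewrite -[leRHS]real_normK ?num_real// lerXn2r ?nnegrE// vmin_le.
Qed.

(** * Probability of the recovery event *)

Lemma measurable_finite_valued (d : measure_display) (T : measurableType d) (I : finType)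
    (Y : T -> I) (Q : I -> Prop) :
  (forall f, measurable [set w | Y w = f]) -> measurable [set w | Q (Y w)].
Proof.
move=> mY; rewrite [X in measurable X](_ : _ =
    [set w | exists2 f, f \in [seq f <- enum I | `[< Q f >]] & [set w | Y w = f] w]).
  exact: measurable_exists_in.
apply/seteqP; split => w /=.
  by move=> QY; exists (Y w) => //; rewrite mem_filter mem_enum andbT; apply/asboolP.
by move=> [f]; rewrite mem_filter => /andP[/asboolP Qf _] ->.
Qed.

Lemma measurable_forall_fin (d : measure_display) (T : measurableType d) (I : finType)
    (F : I -> set T) :
  (forall i, measurable (F i)) -> measurable [set w | forall i, F i w].
Proof.
move=> mF; rewrite [X in measurable X](_ : _ = \bigcap_(i in [set: I]) F i).
  by apply: fin_bigcap_measurable => //; exact: finite_finset.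
by apply/seteqP; split => w /= Fw i; [move=> _|]; apply: Fw.
Qed.

Lemma measurable_imply (d : measure_display) (T : measurableType d) (Q : Prop) (F : set T) :
  measurable F -> measurable [set w | Q -> F w].
Proof.
move=> mF; have [q|nq] := pselect Q.
  by rewrite [X in measurable X](_ : _ = F)//; apply/seteqP; split => w /=; auto.
by rewrite [X in measurable X](_ : _ = setT)//; apply/seteqP; split => w //= _ /nq.
Qed.

(** Needed for monotonicity of [P] at the end of the main proof. The event is a finite combination
    of comparisons between the measurable [|W i|] and of events about the finite-valued [f]. *)
Lemma measurable_support_recovered (R : realType) (n p k : nat) (X : 'M[R]_(n, p))
    (b : 'I_k -> R) (d : measure_display) (T : measurableType d)
    (f : T -> {ffun 'I_k -> 'I_p}) (eta : 'I_n -> T -> R) (Q : nat -> Prop) :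
  (forall g, measurable [set w | f w = g]) ->
  (forall i, measurable_fun setT (eta i)) ->
  measurable [set w | forall d : nat, (d <= p)%N -> Q d -> forall Shat : {set 'I_p},
    alg1_output X (X *m place (f w) b + \col_(i < n) eta i w) d Shat ->
    support_of (f w) \subset Shat].
Proof.
move=> mf meta.
pose W i w := (X^T *m (X *m place (f w) b + \col_(i < n) eta i w)) i 0.
have mW i : measurable_fun setT (W i).
  have -> : W i = fun w => \sum_(j < k) b j * colip X i (f w j) + \sum_(r < n) X r i * eta r w.
    apply/funext => w; rewrite /W trmx_mul_placeE; congr (_ + _).
    by apply: eq_bigr => r _; rewrite mxE.
  apply: measurable_funD.
    move=> _ B mB; rewrite setTI.
    exact: (@measurable_finite_valued _ _ _ f
      (fun g : {ffun 'I_k -> 'I_p} => B (\sum_(j < k) b j * colip X i (g j))) mf).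
  by apply: measurable_sum => r; apply: measurable_funM.
(* The bound [d <= p] makes the quantifier over [d] finite, and the implication from a valid output
   is written as a union with a complement. *)
rewrite [X in measurable X](_ : _ =
  [set w | forall d : 'I_p.+1, [set w | Q d -> [set w | forall Shat : {set 'I_p},
    (~` [set w | #|Shat| = d :> nat /\ [set w | forall i j, i \in Shat -> j \notin Shat -> `|W j w| <= `|W i w| ] w]
     `|` [set w | support_of (f w) \subset Shat]) w] w] w]).
  apply: measurable_forall_fin => d0; apply: measurable_imply; apply: measurable_forall_fin => Shat.
  apply: measurableU; last exact:
    (@measurable_finite_valued _ _ _ f (fun g : {ffun 'I_k -> 'I_p} => support_of g \subset Shat) mf).
  apply: measurableC; apply: (@measurableI _ _ [set w | #|Shat| = d0 :> nat]).
    by have [e|e] := pselect (#|Shat| = d0 :> nat);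
      [rewrite [X in measurable X](_ : _ = setT)|rewrite [X in measurable X](_ : _ = set0)] => //;
      apply/seteqP; split => w.
  apply: (@measurable_forall_fin _ _ _ (fun i => [set w | forall j, i \in Shat -> j \notin Shat -> `|W j w| <= `|W i w|])) => i.
  apply: (@measurable_forall_fin _ _ _ (fun j => [set w | i \in Shat -> j \notin Shat -> `|W j w| <= `|W i w|])) => j.
  apply: (@measurable_imply _ _ _ ([set w | j \notin Shat -> `|W j w| <= `|W i w|])).
  apply: (@measurable_imply _ _ _ ([set w | `|W j w| <= `|W i w|])).
  rewrite -[X in measurable X]setTI; apply: measurable_fun_le => //;
    by apply: measurableT_comp.
apply/seteqP; split => w /= H.
  move=> d0 Qd Shat; have [a|na] := pselect (alg1_output X
      (X *m place (f w) b + \col_(i < n) eta i w) d0 Shat); last by left.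
  by right; apply: H a => //; rewrite -ltnS.
move=> d0 d0p Qd Shat a.
by have [//|] := H (Ordinal (d0p : (d0 < p.+1)%N)) Qd Shat.
Qed.

(** Non-injective draws have probability 0, so adding them to the event costs nothing; outside the
    event, injectivity of the draw then comes for free. *)
Lemma uniform_injection_tail_le (R : realType) (k p : nat) (g : 'I_p -> R) (M : R)
    (b : 'I_k -> R) (t l : R) (d : measure_display) (T : measurableType d)
    (P : probability T R) (f : T -> {ffun 'I_k -> 'I_p}) :
  (0 < k)%N -> (k + k <= p)%N -> (forall x, `|g x| <= M) -> 0 <= l ->
  (forall h, measurable [set w | f w = h]) ->
  (forall h, P [set w | f w = h] = (if injectiveb h then (n_inj k p)%:R^-1 else 0)%:E) ->
  (P [set w | ~~ injectiveb (f w) \/ (t <= \sum_(j < k) b j * g (f w j))%R] <=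
   (expR (- (l * t) + l * ((\sum_(j < k) b j) * ((\sum_x g x) / p%:R))
     + 16 * M ^+ 2 * (l ^+ 2 * \sum_(j < k) b j ^+ 2)))%:E)%E.
Proof.
move=> k0 kp gM l0 mf Pf.
pose Q (h : {ffun 'I_k -> 'I_p}) := ~~ injectiveb h || (t <= \sum_(j < k) b j * g (h j)).
rewrite [X in P X](_ : _ = [set w | exists2 h, h \in [seq h <- enum {: {ffun 'I_k -> 'I_p}} | Q h]
   & [set w | f w = h] w]); last first.
  apply/seteqP; split => w /=.
    by move=> /orP Qw; exists (f w) => //; rewrite mem_filter mem_enum andbT.
  by move=> [h]; rewrite mem_filter => /andP[/orP Qh _] ->.
apply: (le_trans (measure_exists_in_le _ _ mf)).
rewrite (eq_bigr _ (fun h _ => Pf h)).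
rewrite sumEFin lee_fin big_filter big_enum_cond/=.
have N0 : 0 < (n_inj k p)%:R :> R.
  by rewrite ltr0n n_injE ffact_gt0 (leq_trans _ kp)// leq_addr.
rewrite -big_mkcondr/=.
rewrite (eq_bigl (fun h : {ffun 'I_k -> 'I_p} => injectiveb h && (t <= \sum_(j < k) b j * g (h j)))); last first.
  by move=> h; rewrite /Q; case: (injectiveb h); rewrite ?andbT ?andbF.
have := card_inj_tail_le b t k0 kp gM l0.
rewrite -sum1dep_card natr_sum -ler_pdivrMl// mulr_sumr.
by rewrite (eq_bigr (fun=> (n_inj k p)%:R^-1)) // => h _; exact: mulr1.
Qed.

(** The second hypothesis gives [k * D = sqrt k * (sqrt k * D) <= sqrt k], hence
    [k <= sqrt k / D]. *)
Lemma leq_of_ceil_sqrt_le (R : realType) (k d : nat) (D : R) :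
  0 < D -> Num.sqrt k%:R * D <= 1 ->
  (Num.ceil (Num.sqrt k%:R / D) <= d%:Z)%R -> (k <= d)%N.
Proof.
move=> D0 kD; rewrite ceil_le_int => kd.
rewrite -(ler_nat R); apply: le_trans kd.
rewrite ler_pdivlMr// -{1}[k%:R]sqr_sqrtr// expr2 -mulrA.
by rewrite ler_piMr.
Qed.

Theorem theorem4 (R : realType) (n p k : nat) (X : 'M[R]_(n, p)) (c_mu sigma : R)
  (b : 'I_k -> R)
  (dT : measure_display) (T : measurableType dT) (P : probability T R)
  (pi : T -> {ffun 'I_k -> 'I_p}) (eta : 'I_n -> T -> R) :
  unit_norm_columns X ->
  coherence_property X c_mu ->
  10 * Num.sqrt 2 < c_mu ->
  (k < n)%N ->
  0 < sigma ->
  (* nonzero values of beta, fixed (not depending on the draw) *)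
  (forall j, b j != 0) ->
  (* random support: pi is a uniformly random injection 'I_k -> 'I_p,
     beta = place pi b, support S = image of pi *)
  (forall f, measurable [set w | pi w = f]) ->
  (forall f, P [set w | pi w = f] =
     (if injectiveb f then (n_inj k p)%:R^-1 else 0)%:E) ->
  (* Gaussian noise N(0, sigma^2) in each coordinate *)
  (forall i, measurable_fun setT (eta i)) ->
  (forall i (B : set R), measurable B ->
     P (eta i @^-1` B) = normal_prob 0 sigma B) ->
  (* mutual independence of pi, eta_1, ..., eta_n *)
  (forall (A : {set {ffun 'I_k -> 'I_p}}) (B : 'I_n -> set R),
     (forall i, measurable (B i)) ->
     P ([set w | pi w \in A] `&` \bigcap_(i in [set: 'I_n]) (eta i @^-1` B i)) =
     (P [set w | pi w \in A] * \prod_(i < n) P (eta i @^-1` B i))%E) ->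
  (2 * n <= p)%N -> expR (5 : R) <= p%:R ->
  k%:R < (wc_coherence X ^- 2) / (c_mu ^+ 2 * ln p%:R) ->
  vmin b / l2norm b >
    2 * c_mu * wc_coherence X * Num.sqrt (ln p%:R)
    + 4 * Num.sqrt (sigma ^+ 2 * ln p%:R) / l2norm b ->
  let y := fun w => X *m place (pi w) b + \col_(i < n) eta i w in
  ((1 - 6 / p%:R)%:E <
   P [set w | forall d : nat, (d <= p)%N ->
        (Num.ceil (Num.sqrt k%:R /
           (vmin b / l2norm b - 2 * c_mu * wc_coherence X * Num.sqrt (ln p%:R)
            - 4 * Num.sqrt (sigma ^+ 2 * ln p%:R) / l2norm b)) <= d%:Z)%R ->
        forall Shat : {set 'I_p}, alg1_output X (y w) d Shat ->
          support_of (pi w) \subset Shat])%E.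
Proof.
move=> X1 [c0 [_ nu_lt]] c_gt kn s0 b0 mpi Ppi meta Peta indep np ep _ gap; cbv zeta.
set mu := wc_coherence X in nu_lt gap *; set S := Num.sqrt (sigma ^+ 2 * ln p%:R) in gap *.
set L := Num.sqrt (ln p%:R) in gap *; set B := l2norm b in gap *.
have mu_ge0 : 0 <= mu := wc_coherence_ge0 X.
have S_ge0 : 0 <= S := sqrtr_ge0 _.
have L_ge0 : 0 <= L := sqrtr_ge0 _.
(* For [k = 0] the norm is 0 and division by it yields 0, so [gap] would put a nonnegative number
   strictly below 0. *)
have k0 : (0 < k)%N.
  rewrite lt0n; apply/negP => /eqP k0; move: gap; rewrite ltNge => /negP; apply.
  have -> : B = 0.
    rewrite /B /l2norm big1 ?sqrtr0// => j _.
    by have := ltn_ord j; rewrite [X in (_ < X)%N]k0.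
  by rewrite invr0 !mulr0 addr0 !mulr_ge0// ltW.
have B0 : 0 < B by exact: l2norm_gt0.
have n0 : (0 < n)%N by apply: leq_ltn_trans kn.
have p1 : (1 < p)%N by apply: leq_trans np; rewrite mul2n -addnn -[1%N.+1]/(1 + 1)%N leq_add.
have p0 : 0 < p%:R :> R by rewrite ltr0n ltnW.
have kp : (k + k <= p)%N by apply: leq_trans np; rewrite mul2n -addnn leq_add// ltnW.
have lnp : 5 <= ln p%:R :> R by rewrite -[5](expRK 5) ler_ln ?posrE ?expR_gt0.
have L2 : L ^+ 2 = ln p%:R by rewrite sqr_sqrtr//; lra.
have L1 : 1 <= L by nra.
have c14 : 14 <= c_mu.
  have q0 : 0 <= Num.sqrt 2 :> R := sqrtr_ge0 _.
  have q2 : Num.sqrt 2 ^+ 2 = 2 :> R by rewrite sqr_sqrtr.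
  by apply: le_trans (ltW c_gt); nra.
have sn0 : 0 < Num.sqrt n%:R :> R by rewrite sqrtr_gt0 ltr0n.
have nu_ge0 : 0 <= avg_coherence X.
  by rewrite mulr_ge0 ?invr_ge0//; exact: bigmax_ge_id.
(* A nonnegative average coherence strictly below [mu / sqrt n] excludes [mu = 0], so dividing by
   [mu] in the Chernoff parameter is legitimate. *)
have mu0 : 0 < mu.
  by have := le_lt_trans nu_ge0 nu_lt; rewrite pmulr_lgt0 ?invr_gt0.
have S2 : S ^+ 2 = sigma ^+ 2 * ln p%:R.
  by rewrite sqr_sqrtr// mulr_ge0 ?sqr_ge0//; lra.
have S0 : 0 < S.
  by rewrite sqrtr_gt0 mulr_gt0 ?exprn_gt0//; lra.
pose t := c_mu * mu * L * B; pose u := 2 * S.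
(* Cauchy-Schwarz bounds the sum of the [b j] by [sqrt k * B], hence by [sqrt n * B]; this [sqrt n]
   cancels the one in the bound on the average coherence. *)
have mean_le i : `|(\sum_(j < k) b j) * ((\sum_m offdiag X i m) / p%:R)| <= mu * B.
  have sb : `|\sum_(j < k) b j| <= Num.sqrt n%:R * B.
    rewrite -(@ler_pXn2r _ 2)// ?nnegrE//; last by rewrite mulr_ge0// ltW.
    rewrite real_normK ?num_real// exprMn sqr_sqrtr// sqr_l2norm.
    apply: (le_trans (sqr_sum_le b)); rewrite ler_wpM2r// ?ler_nat 1?ltnW//.
    by apply: sumr_ge0 => j _; exact: sqr_ge0.
  have so : `|(\sum_m offdiag X i m) / p%:R| <= mu / Num.sqrt n%:R.
    apply: le_trans (ltW nu_lt).
    rewrite normrM normfV (ger0_norm (ltW p0)) ler_pdivrMr// mulrC.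
    apply: (le_trans (offdiag_sum_le _ i p1)).
    by rewrite ler_wpM2r// ler_nat leq_pred.
  rewrite normrM; apply: (le_trans (ler_pM _ _ sb so)) => //.
  by rewrite le_eqVlt; apply/orP; left; apply/eqP; field; rewrite gt_eqF.
pose E1 i := [set w | ~~ injectiveb (pi w) \/ (t <= \sum_(j < k) b j * offdiag X i (pi w j))%R].
pose E2 i := [set w | ~~ injectiveb (pi w) \/ (t <= \sum_(j < k) b j * - offdiag X i (pi w j))%R].
pose E3 i := [set w | (u <= \sum_(r < n) X r i * eta r w)%R].
pose E4 i := [set w | (u <= \sum_(r < n) - X r i * eta r w)%R].
pose e := expR (- (2 * ln p%:R)) : R.
have eE : e = (p%:R ^+ 2)^-1.
  by rewrite /e expRN mulr_natl mulr2n expRD lnK ?posrE// expr2.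
have PE12 (g : 'I_p -> R) : (forall m, `|g m| <= mu) ->
    (\sum_(j < k) b j) * ((\sum_m g m) / p%:R) <= mu * B ->
    (P [set w | ~~ injectiveb (pi w) \/ (t <= \sum_(j < k) b j * g (pi w j))%R] <= e%:E)%E.
  (* With this [l] the three terms of the exponent are [- c_mu L^2 / 2], at most [L / 2], and
     [4 L^2]. Since [c_mu >= 14] and [L >= 1], their sum is at most [-2 L^2 = -2 ln p]. *)
  move=> g_le mean_g; pose l := L / (2 * mu * B).
  have l0 : 0 <= l by rewrite divr_ge0// !mulr_ge0// ltW.
  apply: (le_trans (uniform_injection_tail_le b t k0 kp g_le l0 mpi Ppi)).
  rewrite lee_fin ler_expR.
  have h1 : l * t = c_mu * L ^+ 2 / 2 by rewrite /l /t; field; rewrite !gt_eqF.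
  have h2 := ler_wpM2l l0 mean_g.
  have h3 : l * (mu * B) = L / 2 by rewrite /l; field; rewrite !gt_eqF.
  have h4 : 16 * mu ^+ 2 * (l ^+ 2 * \sum_(j < k) b j ^+ 2) = 4 * L ^+ 2.
    by rewrite -sqr_l2norm -/B /l; field; rewrite !gt_eqF.
  rewrite h4 h1 -L2; rewrite h3 in h2.
  by apply: (@le_trans _ _ (- (c_mu * L ^+ 2 / 2) + L / 2 + 4 * L ^+ 2)); nra.
have PE1 i : (P (E1 i) <= e%:E)%E.
  apply: (PE12 (offdiag X i)) => [m|]; first exact: offdiag_le.
  exact: le_trans (ler_norm _) (mean_le i).
have PE2 i : (P (E2 i) <= e%:E)%E.
  apply: (PE12 (fun m => - offdiag X i m)) => [m|]; first by rewrite normrN; exact: offdiag_le.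
  rewrite sumrN mulNr mulrN; apply: le_trans (mean_le i).
  by rewrite -normrN; exact: ler_norm.
have indep' (A : 'I_n -> set R) : (forall i, measurable (A i)) ->
    P (\bigcap_(i in [set: 'I_n]) (eta i @^-1` A i)) =
    (\prod_(i < n) normal_prob 0 sigma (A i))%E.
  move=> mA; have := indep finset.setT A mA.
  rewrite [X in P (X `&` _)](_ : _ = setT); last by apply/seteqP; split => w //= _; rewrite inE.
  rewrite [X in (P X * _)%E](_ : _ = setT); last by apply/seteqP; split => w //= _; rewrite inE.
  rewrite setTI probability_setT mul1e => ->.
  by apply: eq_bigr => i _; exact: Peta.
have u0 : 0 < u by rewrite /u mulr_gt0.
(* The choice [u = 2 S] makes the Gaussian exponent exactly [-2 ln p], matching the bound for the
   random draw. *)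
have ue : expR (- (u ^+ 2 / (2 * sigma ^+ 2))) = e.
  by rewrite /e /u exprMn S2; congr expR; field; rewrite gt_eqF.
have PE3 i : (P (E3 i) <= e%:E)%E.
  by rewrite -ue; apply: gaussian_comb_tail_le => //; exact: X1.
have PE4 i : (P (E4 i) <= e%:E)%E.
  rewrite -ue; apply: gaussian_comb_tail_le => //; rewrite -(X1 i).
  by apply: eq_bigr => r _; rewrite sqrrN expr2.
have mE1 i : measurable (E1 i).
  exact: (@measurable_finite_valued _ _ _ pi (fun f : {ffun 'I_k -> 'I_p} =>
    ~~ injectiveb f \/ (t <= \sum_(j < k) b j * offdiag X i (f j))%R) mpi).
have mE2 i : measurable (E2 i).
  exact: (@measurable_finite_valued _ _ _ pi (fun f : {ffun 'I_k -> 'I_p} =>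
    ~~ injectiveb f \/ (t <= \sum_(j < k) b j * - offdiag X i (f j))%R) mpi).
have mlin (x : 'I_n -> R) : measurable [set w | (u <= \sum_(r < n) x r * eta r w)%R].
  rewrite -[X in measurable X]setTI; apply: measurable_fun_le => //.
  by apply: measurable_sum => r; apply: measurable_funM.
have mE3 i : measurable (E3 i) := mlin _.
have mE4 i : measurable (E4 i) := mlin _.
pose F i := (E1 i `|` E2 i) `|` (E3 i `|` E4 i).
have mF i : measurable (F i) by apply: measurableU; apply: measurableU.
have PF i : (P (F i) <= (4 * e)%:E)%E.
  apply: (le_trans (measureU2 _ (measurableU _ _ (mE1 i) (mE2 i)) (measurableU _ _ (mE3 i) (mE4 i)))).
  have -> : 4 * e = (e + e) + (e + e) by ring.
  rewrite !EFinD; apply: leeD.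
    by apply: (le_trans (measureU2 _ (mE1 i) (mE2 i))); exact: leeD (PE1 i) (PE2 i).
  by apply: (le_trans (measureU2 _ (mE3 i) (mE4 i))); exact: leeD (PE3 i) (PE4 i).
pose bad := [set w | exists2 i, i \in enum 'I_p & F i w].
have mbad : measurable bad by exact: measurable_exists_in.
have Pbad : (P bad <= (4 / p%:R)%:E)%E.
  apply: (le_trans (measure_exists_in_le _ _ mF)).
  apply: (@le_trans _ _ (\sum_(i <- enum 'I_p) (4 * e)%:E)%E).
    by apply: lee_sum => i _; exact: PF.
  rewrite sumEFin lee_fin big_const_seq count_predT size_enum_ord iter_addr_0.
  by rewrite eE -mulr_natl le_eqVlt; apply/orP; left; apply/eqP; field; rewrite gt_eqF.
(* The slack between [4 / p] and [6 / p] provides the strict inequality. *)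
apply: (@lt_le_trans _ _ (P (~` bad))).
  rewrite probability_setC//.
  have Pfin : P bad \is a fin_num by exact: fin_num_measure.
  move: Pbad; rewrite -(fineK Pfin) lee_fin -EFinB lte_fin => Pb.
  have : 0 < p%:R^-1 :> R by rewrite invr_gt0.
  by lra.
apply: le_measure; rewrite ?inE.
- exact: measurableC.
- exact: (@measurable_support_recovered _ _ _ _ X b _ _ pi eta (fun d => (Num.ceil _ <= d%:Z)%R)).
move=> w nbad d dp; set D := _ - _ - _ => dD Shat.
have notF i : ~ F i w by move=> Fi; apply: nbad; exists i => //; rewrite mem_enum.
have D0 : 0 < D by rewrite /D; lra.
have vB : 2 * t + 2 * u < vmin b.
  move: gap; rewrite ltr_pdivlMr// mulrDl divfK ?gt_eqF//.
  by rewrite /t /u; lra.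
(* Every [E1 i] contains the non-injective draws, so avoiding it at index 0 is enough. *)
have pi_inj : injective (pi w).
  apply/injectiveP; apply: contrapT => /negP ni.
  by apply: (notF (Ordinal (ltnW p1))); left; left; left.
have Zlt i : `|\sum_(j < k) b j * offdiag X i (pi w j)| < t.
  rewrite ltr_norml; apply/andP; split; rewrite ltNge; apply/negP => h; apply: (notF i).
    left; right; right; under eq_bigr do rewrite mulrN.
    by rewrite sumrN lerNr.
  by left; left; right.
have Nlt i : `|\sum_(r < n) X r i * eta r w| < u.
  rewrite ltr_norml; apply/andP; split; rewrite ltNge; apply/negP => h; apply: (notF i).
    right; right; rewrite /E4/=; under eq_bigr do rewrite mulNr.
    by rewrite sumrN lerNr.
  by right; left.
apply: alg1_output_support_subset; last first.
  apply: leq_trans (leq_imset_card _ _) _; rewrite card_ord.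
  apply: leq_of_ceil_sqrt_le dD => //.
  (* [D] is at most [vmin b / B], and [k] entries of size at least [vmin b] force
     [sqrt k * vmin b <= B]. *)
  apply: (@le_trans _ _ (Num.sqrt k%:R * (vmin b / B))).
    rewrite ler_wpM2l ?sqrtr_ge0//.
    have hA : 0 <= 2 * c_mu * mu * L by rewrite !mulr_ge0// ltW.
    have hS : 0 <= 4 * S / B by rewrite divr_ge0 ?mulr_ge0// ltW.
    by rewrite /D; lra.
  by rewrite mulrA ler_pdivrMr// mul1r sqrt_vmin_le_l2norm.
have wE i : (X^T *m (X *m place (pi w) b + \col_(r < n) eta r w)) i 0 =
    \sum_(j < k) b j * colip X i (pi w j) + \sum_(r < n) X r i * eta r w.
  rewrite trmx_mul_placeE; congr (_ + _).
  by apply: eq_bigr => r _; rewrite mxE.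
move=> i j /imsetP[l _ ->] jS; rewrite !wE.
rewrite colip_sum_offdiag_in// colip_sum_offdiag_out//.
have := Zlt (pi w l); have := Nlt (pi w l); have := Zlt j; have := Nlt j.
set Z1 := \sum_(_ < k) _; set N1 := \sum_(_ < n) _.
set Z2 := \sum_(_ < k) _; set N2 := \sum_(_ < n) _ => Nj Zj Nl Zl.
have bl : `|b l| <= `|b l + Z2 + N2| + (`|Z2| + `|N2|).
  have {1}-> : b l = (b l + Z2 + N2) - (Z2 + N2) by ring.
  by apply: (le_trans (ler_normB _ _)); rewrite lerD2l ler_normD.
by have := vmin_le b l; have := ler_normD Z1 N1; lra.
Qed.
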